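(* The $\mathcal{F}$-depth of any infinite graph is finite.
   Context: All graphs are simple (no loops or multiple edges), labeled, and may be finite or infinite. A forest of $H$ is an acyclic subgraph; a maximal forest is a forest of $H$ not properly contained in another forest of $H$. The forest graph $\mathcal{F}(H)$ has as vertices the maximal forests of $H$, two being adjacent iff $F_2=F_1-e+f$ for some edges $e\in F_1$, $f\notin F_1$. $\mathcal{F}^0(H)=H$, $\mathcal{F}^n(H)=\mathcal{F}(\mathcal{F}^{n-1}(H))$. A graph $H$ is an $\mathcal{F}$-root of $G$ if $\mathcal{F}(H)\cong G$. The $\mathcal{F}$-depth of $G$ is $\sup\{n\in\mathbb{N}: G\cong\mathcal{F}^n(H)\text{ for some graph }H\}$, and is defined to be $0$ if $G$ has no $\mathcal{F}$-root. *)

(* Defs.v *)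
From mathcomp Require Import all_boot.
From mathcomp Require Import boolp classical_sets functions cardinality.

Set Implicit Arguments.
Unset Strict Implicit.
Unset Printing Implicit Defensive.

Local Open Scope classical_set_scope.

Record sgraph := SGraph {
  vertex :> Type;
  adj : vertex -> vertex -> Prop;
  adj_sym : forall x y, adj x y -> adj y x;
  adj_irr : forall x, ~ adj x x
}.

Definition isomorphic (G H : sgraph) : Prop :=
  exists f : G -> H, bijective f /\ forall x y, adj x y <-> adj (f x) (f y).

Record subgraph (H : sgraph) := Subgraph {
  sverts : set H;
  sadj : H -> H -> Prop;
  sadj_sym : forall x y, sadj x y -> sadj y x;
  sadj_sub : forall x y, sadj x y -> [/\ adj x y, sverts x & sverts y]
}.

Definition contained (H : sgraph) (F F' : subgraph H) : Prop :=
  sverts F `<=` sverts F' /\ forall x y, sadj F x y -> sadj F' x y.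

Definition properly_contained (H : sgraph) (F F' : subgraph H) : Prop :=
  contained F F' /\ ~ contained F' F.

(* Cycles are finite, of length at least 3; [ordS] is the successor modulo n. *)
Definition has_cycle (V : Type) (e : V -> V -> Prop) : Prop :=
  exists (n : nat) (c : 'I_n -> V),
    [/\ 3 <= n, injective c & forall i, e (c i) (c (ordS i))].

Definition forest (H : sgraph) (F : subgraph H) : Prop := ~ has_cycle (sadj F).

Definition maximal_forest (H : sgraph) (F : subgraph H) : Prop :=
  forest F /\ ~ exists F' : subgraph H, forest F' /\ properly_contained F F'.

(* The unordered pairs {x, y} and {a, b} are equal. *)
Definition same_edge (V : Type) (a b x y : V) : Prop :=
  (x = a /\ y = b) \/ (x = b /\ y = a).

(* F2 = F1 - e + f with e = {a, b} and f = {c, d}; that f is an edge of H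
   follows from F2 being a subgraph of H. *)
Definition exchange (H : sgraph) (F1 F2 : subgraph H) : Prop :=
  exists a b c d : H,
    [/\ sadj F1 a b, ~ sadj F1 c d, sverts F2 = sverts F1 &
        forall x y, sadj F2 x y <->
          (sadj F1 x y /\ ~ same_edge a b x y) \/ same_edge c d x y].

Lemma exchange_sym (H : sgraph) (F1 F2 : subgraph H) :
  exchange F1 F2 -> exchange F2 F1.
Proof.
move=> [a [b [c [d [ab ncd eqV E]]]]]; exists c, d, a, b.
have ncd' x y : same_edge c d x y -> ~ sadj F1 x y.
  by case=> [[-> ->]//|[-> ->]] /sadj_sym.
have ab' x y : same_edge a b x y -> sadj F1 x y.
  by case=> [[-> ->]//|[-> ->]]; exact: sadj_sym.
split=> //.
- by apply/E; right; left.
- move=> /E [[_]|/ncd'//]; apply; by left.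
- move=> x y; split.
    move=> xy; have [|nab] := pselect (same_edge a b x y); first by right.
    left; split; first by apply/E; left.
    by move=> /ncd'.
  case=> [[/E[[]//|//]]|/ab' //].
Qed.

Lemma exchange_irr (H : sgraph) (F : subgraph H) : ~ exchange F F.
Proof. by move=> [a [b [c [d [_ ncd _ E]]]]]; apply/ncd/E; right; left. Qed.

Definition forest_graph (H : sgraph) : sgraph :=
  @SGraph {F : subgraph H | maximal_forest F}
    (fun F1 F2 => exchange (sval F1) (sval F2))
    (fun F1 F2 => @exchange_sym H (sval F1) (sval F2))
    (fun F => @exchange_irr H (sval F)).

Definition forest_graph_iter (n : nat) (H : sgraph) : sgraph :=
  iter n forest_graph H.

Definition Froot (G H : sgraph) : Prop := isomorphic (forest_graph H) G.

Variant enat := Fin of nat | Infty.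

Definition le_enat (u v : enat) : Prop :=
  match u, v with
  | _, Infty => True
  | Infty, Fin _ => False
  | Fin m, Fin n => m <= n
  end.

(* s is the supremum of A in the extended natural numbers. *)
Definition is_sup (A : set nat) (s : enat) : Prop :=
  (forall n, A n -> le_enat (Fin n) s) /\
  (forall u, (forall n, A n -> le_enat (Fin n) u) -> le_enat s u).

Definition is_Fdepth (G : sgraph) (d : enat) : Prop :=
  ((exists H, Froot G H) /\
     is_sup [set n | exists H, isomorphic G (forest_graph_iter n H)] d)
  \/ (~ (exists H, Froot G H) /\ d = Fin 0).

Definition infinite_graph (G : sgraph) : Prop := infinite_set [set: G].

(* Main.v *)
(** Let K be infinite with every vertex in a triangle.  By Zorn's lemma the
    vertices of K are covered by a family Q of triangles, each of which carries
    an independent binary choice of an edge, so that every sequence of choices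
    gives an acyclic graph, with different sequences lying in different maximal
    forests.  As 3|Q| >= |K|, this gives |F(K)| >= 2^|K|, and F(K) again
    satisfies the assumptions: if T is a maximal forest and f a chord, deleting
    from T + f either neighbour of f on its fundamental cycle gives a triangle
    through T.  Conversely |F(K)| <= 2^|K x K|.

    If G = F^(n+1)(H_n) for all n, put K_n = F(H_n), so that exp^n |K_n| <= |G|
    <= exp^(n+1) |K_n| for the iterated exponential exp.  Choose m with |K_m|
    least.  Then exp^(m+2) |K_m| <= exp^(m+2) |K_(m+2)| <= |G| <= exp^(m+1) |K_m|,
    against Cantor's theorem. *)
From mathcomp Require Import all_boot.
From mathcomp Require Import boolp classical_sets functions cardinality.
Require Import Defs.

Set Implicit Arguments.
Unset Strict Implicit.
Unset Printing Implicit Defensive.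

Local Open Scope classical_set_scope.

(** * Cardinality *)

Definition embeds (A B : Type) : Prop := exists f : A -> B, injective f.

Lemma embeds_refl (A : Type) : embeds A A.
Proof. by exists id. Qed.

Lemma embeds_trans (B A C : Type) : embeds A B -> embeds B C -> embeds A C.
Proof. by move=> [f fI] [g gI]; exists (g \o f); exact: inj_comp. Qed.

Lemma embeds_prod (A A' B B' : Type) :
  embeds A A' -> embeds B B' -> embeds (A * B) (A' * B').
Proof.
move=> [f fI] [g gI]; exists (fun p => (f p.1, g p.2)).
by move=> [a b] [a' b'] /= [/fI -> /gI ->].
Qed.

Lemma embeds_set (A B : Type) : embeds A B -> embeds (set A) (set B).
Proof.
move=> [f fI]; exists (fun X => f @` X) => X Y XY; apply/seteqP.
by split=> x Xx; [have : (f @` Y) (f x) by rewrite -XY; exists x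
  | have : (f @` X) (f x) by rewrite XY; exists x]; move=> [y ? /fI <-].
Qed.

(** Diagonal argument for injections: [D] collects the values [f X] that lie outside their own
    [X]. *)
Lemma cantor (A : Type) : ~ embeds (set A) A.
Proof.
move=> [f fI]; pose D : set A := [set x | exists2 X, f X = x & ~ X x].
have [Df|nDf] := pselect (D (f D)).
  by have [X /fI -> ] := Df.
by apply: (nDf); exists D.
Qed.

Fixpoint iter_set (k : nat) (A : Type) : Type :=
  if k is k'.+1 then set (iter_set k' A) else A.

Lemma iter_setSr (k : nat) (A : Type) : iter_set k.+1 A = iter_set k (set A).
Proof. by elim: k => //= k <-. Qed.

Lemma embeds_iter_set (k : nat) (A B : Type) :
  embeds A B -> embeds (iter_set k A) (iter_set k B).
Proof. by move=> AB; elim: k => //= k; exact: embeds_set. Qed.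

Lemma embeds_set_self (A : Type) : embeds A (set A).
Proof. by exists set1 => x y xy; have : [set y] x by rewrite -xy. Qed.

Lemma infinite_sequence (A : Type) (R : set A) :
  infinite_set R <-> exists2 f : nat -> A, injective f & forall n, R (f n).
Proof.
split=> [/infiniteP /card_leP[h]|[f fI fR] Rfin].
  exists (fun n => sval (h (SigSub (mem_set (I : [set: nat] n))))) => [m n|n].
    move=> /eq_sig_hprop hmn.
    have /inj := hmn (fun _ => @Prop_irrelevance _).
    by rewrite !inE => /(_ I I) [].
  by case: (h _) => x /=; rewrite inE.
apply: infinite_nat; apply: sub_finite_set (finite_preimage _ Rfin).
  by move=> n _; exact: fR.
by move=> m n _ _; exact: fI.
Qed.

Lemma infinite_embeds (A : Type) : infinite_set [set: A] <-> embeds nat A.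
Proof.
rewrite infinite_sequence; split=> [[f fI _]|[f fI]]; last by exists f.
by exists f.
Qed.

(** If [A] is finite, listed by [s], a subset is determined by its membership bits along [s], and
    such tuples are finite in number. *)
Lemma infinite_of_set (A : Type) : embeds nat (set A) -> embeds nat A.
Proof.
rewrite -!infinite_embeds => inf fin; apply: inf.
have /finite_seqP[s sE] : finite_set [set: {classic A}] by [].
pose f (X : set {classic A}) := map_tuple (fun p : {classic A} => `[<X p>]) (in_tuple s).
have fI : injective f.
  move=> X Y /(congr1 val) /= /eq_in_map XY; apply/funext => x; apply/propext.
  have /XY e : (x : {classic A}) \in s by have : [set` s] x by rewrite -sE.
  by split=> /asboolP; [rewrite e|rewrite -e] => /asboolP.
apply: sub_finite_set (finite_preimage (B := setT) (f := f) _ finite_finset) => //.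
by move=> X Y _ _; exact: fI.
Qed.

(* A maximal family of disjoint injective sequences covers all but a finite
   set [R], which is absorbed by one of the sequences. *)
Lemma infinite_mul_nat (A : Type) : embeds nat A -> embeds (A * nat) A.
Proof.
move=> [h0 h0I].
pose P (Z : set (nat -> A)) := forall f g m n,
  Z f -> Z g -> f m = g n -> f = g /\ m = n.
have [F FP tot|Z [ZP Zmax]] := @Zorn_bigcup (nat -> A) P.
  move=> f g m n [X FX Xf] [Y FY Yg].
  have [XY|YX] := tot _ _ FX FY; first exact: (FP _ FY) (XY _ Xf) Yg.
  exact: (FP _ FX) Xf (YX _ Yg).
pose R := [set x | forall f n, Z f -> f n <> x].
(* By maximality of [Z], no injective sequence fits inside [R]. *)
have Radd (h : nat -> A) : injective h -> (forall n, R (h n)) -> False.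
  move=> hI hR; apply: (Zmax (Z `|` [set h])).
    split; last by move=> /(_ h (or_intror erefl)) /(hR 0 h 0); apply.
    by move=> f; left.
  move=> f g m n [Zf|->] [Zg|->]; first exact: ZP.
  - by move=> /(hR n f m Zf).
  - by move=> /esym /(hR m g n Zg).
  - by move=> /hI ->.
have [f0 Zf0] : exists f, Z f.
  apply: contrapT => /forallNP Z0; apply: (Radd h0) => // n f m /Z0 //.
have [r rI] : exists r : A -> nat, {in R &, injective r}.
  have [Rfin|Rinf] := pselect (finite_set R).
    by have /countable_injP := finite_set_countable Rfin.
  by move: Rinf => /infinite_sequence[h hI /(Radd _ hI)].
(* Entry n of a sequence in [Z] gets the even code 2n, a point of [R] an odd code on the fixed
   sequence [f0]. *)
have /choice[g gP] : forall x, exists p : (nat -> A) * nat, Z p.1 /\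
    ((exists2 m, p.2 = m.*2 & p.1 m = x) \/ (R x /\ p.2 = (r x).*2.+1)).
  move=> x; have [[f [n [Zf fx]]]|nx] :=
      pselect (exists f n, Z f /\ f n = x).
    by exists (f, n.*2); split=> //; left; exists n.
  exists (f0, (r x).*2.+1); split=> //; right; split=> // f n Zf fx.
  by apply: nx; exists f, n.
have gI : injective g.
  move=> x y xy; have := gP x; have := gP y; rewrite -xy => -[_].
  case=> [[m -> gy]|[Ry ->]] [_].
    case=> [[n /double_inj <-]|[_ /(congr1 odd)]]; first by rewrite gy.
    by rewrite /= !odd_double.
  case=> [[n /(congr1 odd)]|[Rx []]]; first by rewrite /= !odd_double.
  by move=> /double_inj /rI ->; rewrite ?inE.
(* The pair (x, k) goes to the entry of the sequence of x whose position codes the index of x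
   together with k. *)
exists (fun p => (g p.1).1 (pickle ((g p.1).2, p.2))).
move=> [x k] [y l] /= xy.
have [Zx _] := gP x; have [Zy _] := gP y.
have [e1 /(pcan_inj pickleK) [e2 ->]] := ZP _ _ _ _ Zx Zy xy.
by congr pair; apply: gI; rewrite (surjective_pairing (g x)) e1 e2 -surjective_pairing.
Qed.

Lemma infinite_mul_finite (n : nat) (A : Type) :
  embeds nat A -> embeds (A * 'I_n) A.
Proof.
move=> /infinite_mul_nat; apply: embeds_trans.
apply: embeds_prod; first exact: embeds_refl.
by exists val; exact: val_inj.
Qed.

(** Two disjoint copies of [A] fit into [A], so a pair of subsets becomes the union of two tagged
    copies. *)
Lemma infinite_set_sq (A : Type) :
  embeds nat A -> embeds (set A * set A) (set A).
Proof.
move=> /(infinite_mul_finite 2) [s sI].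
pose f (X Y : set A) :=
  [set s (x, inord 0) | x in X] `|` [set s (x, inord 1) | x in Y].
exists (fun p => f p.1 p.2).
have i01 : inord 0 <> inord 1 :> 'I_2.
  by move=> /(congr1 val); rewrite /= !inordK.
have sub X Y X' Y' : f X Y = f X' Y' -> X `<=` X' /\ Y `<=` Y'.
  move=> E; split=> x Xx.
    have : f X' Y' (s (x, inord 0)) by rewrite -E; left; exists x.
    by case=> -[y ? /sI[]]; [move=> <-|move=> _ /esym].
  have : f X' Y' (s (x, inord 1)) by rewrite -E; right; exists x.
  by case=> -[y ? /sI[]]; [move=> _|move=> <-].
move=> [X Y] [X' Y'] /= E.
by have [? ?] := sub _ _ _ _ E; have [? ?] := sub _ _ _ _ (esym E);
  congr pair; apply/seteqP.
Qed.

(* Zorn on the sets of points of the product on which all projections are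
   injective: for a maximal such set, some projection is onto. *)
Lemma least_cardinal (A : nat -> Type) :
  exists i0, forall i, embeds (A i0) (A i).
Proof.
pose P (X : set (forall i, A i)) := forall i p q,
  X p -> X q -> p i = q i -> p = q.
have [F FP tot|X [XP Xmax]] := @Zorn_bigcup (forall i, A i) P.
  move=> i p q [Y FY Yp] [Z FZ Zq].
  have [YZ|ZY] := tot _ _ FY FZ; first exact: (FP _ FZ) (YZ _ Yp) Zq.
  exact: (FP _ FY) Yp (ZY _ Zq).
have [i0 i0P] : exists i0, forall a, exists p, X p /\ p i0 = a.
  apply: contrapT => /forallNP H.
  have Hp : forall i, exists a : A i, forall p, X p -> p i <> a.
    move=> i; have /existsNP[a Ha] := H i; exists a => p Xp pa.
    by apply: Ha; exists p.
  (* If no projection of [X] is onto, the point [p] of missed coordinates can be added to [X]. *)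
  pose p i := sval (cid (Hp i)).
  have pP i q : X q -> q i <> p i by exact: (svalP (cid (Hp i))).
  apply: (Xmax (X `|` [set p])).
    split; first by move=> q; left.
    by move=> /(_ p (or_intror erefl)) /(pP 0).
  move=> i q q' [Xq|->] [Xq'|->] //; first exact: XP.
    by move=> /pP -/(_ Xq).
  by move=> /esym /pP -/(_ Xq').
have [p pP] := choice i0P.
exists i0 => i; exists (fun a => p a i) => a b.
have [Xa pa] := pP a; have [Xb pb] := pP b.
by move=> /(XP _ _ _ Xa Xb) pab; rewrite -pa pab.
Qed.

(** * Connectivity and acyclicity *)

Section Connectivity.
Variable V : Type.
Implicit Types (e r : V -> V -> Prop) (a b c d x y z : V).

Definition symm e := forall x y, e x y -> e y x.
Definition subrel_of r e := forall x y, r x y -> e x y.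

Inductive conn e x : V -> Prop :=
| conn0 : conn e x x
| connS y z : conn e x y -> e y z -> conn e x z.

Definition del e a b x y := e x y /\ ~ same_edge a b x y.
Definition add e a b x y := e x y \/ same_edge a b x y.

(** Every edge is a bridge; this form avoids handling explicit cycles. *)
Definition acyclic e := forall x y, e x y -> ~ conn (del e x y) x y.

Lemma same_edge_sym a b x y : same_edge a b x y -> same_edge a b y x.
Proof. by case=> -[-> ->]; [right|left]. Qed.

Lemma symm_del e a b : symm e -> symm (del e a b).
Proof. by move=> es x y [/es exy n]; split=> // /same_edge_sym. Qed.

Lemma symm_add e a b : symm e -> symm (add e a b).
Proof. by move=> es x y [/es|/same_edge_sym]; [left|right]. Qed.

Lemma conn1 e x y : e x y -> conn e x y.
Proof. exact/connS/conn0. Qed.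

Lemma conn_last e x y : conn e x y -> x = y \/ exists u, e u y.
Proof. by case=> [|u z _ uz]; [left|right; exists u]. Qed.

Lemma conn_trans e y x z : conn e x y -> conn e y z -> conn e x z.
Proof. by move=> xy; elim=> // u v _ xu; exact: connS. Qed.

Lemma conn_mono r e x y :
  (forall u v, r u v -> conn e u v) -> conn r x y -> conn e x y.
Proof.
move=> re; elim=> [|u v _ xu /re]; first exact: conn0.
exact: conn_trans.
Qed.

Lemma conn_sub r e x y : subrel_of r e -> conn r x y -> conn e x y.
Proof. by move=> re; apply: conn_mono => u v /re /conn1. Qed.

Lemma conn_sym e x y : symm e -> conn e x y -> conn e y x.
Proof.
move=> es; elim=> [|u v _ ux /es vu]; first exact: conn0.
exact: conn_trans (conn1 vu) ux.
Qed.

(** A walk can be shortened so as to cross the new edge at most once, in one of its two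
    directions. *)
Lemma conn_add e c d x y : conn (add e c d) x y ->
  [\/ conn e x y, conn e x c /\ conn e d y | conn e x d /\ conn e c y].
Proof.
elim=> [|u v _ IH uv]; first by constructor 1; exact: conn0.
case: uv => [uv|[[eu ->]|[eu ->]]].
- case: IH => [xu|[xc du]|[xd cu]].
  + by constructor 1; exact: connS uv.
  + by constructor 2; split=> //; exact: connS uv.
  + by constructor 3; split=> //; exact: connS uv.
- rewrite eu in IH; case: IH => [xc|[xc _]|[xd _]].
  + by constructor 2; split=> //; exact: conn0.
  + by constructor 2; split=> //; exact: conn0.
  + by constructor 1.
- rewrite eu in IH; case: IH => [xd|[xc _]|[xd _]].
  + by constructor 3; split=> //; exact: conn0.
  + by constructor 1.
  + by constructor 3; split=> //; exact: conn0.
Qed.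

Lemma acyclic_sub r e : subrel_of r e -> acyclic e -> acyclic r.
Proof.
move=> re eA x y /re /eA exy rxy; apply: exy; apply: conn_sub rxy.
by move=> u v [/re].
Qed.

(** A cycle of the larger graph must use the new edge, and the rest of it would connect [c] to [d]
    in [e]. *)
Lemma acyclic_add e c d : symm e -> acyclic e -> ~ conn e c d ->
  acyclic (add e c d).
Proof.
move=> es eA ncd x y exy; have [cdxy|ncdxy] := pselect (same_edge c d x y).
  move=> /(@conn_sub _ e) xy; have {}xy : conn e x y.
    apply: xy => u v [[//|cduv]] []; move: cdxy cduv.
    by case=> -[-> ->] [] [-> ->]; [left|right|right|left].
  by case: cdxy xy => -[-> ->] // /(conn_sym es).
case: exy => // exy /(@conn_sub _ (add (del e x y) c d)) xy.
have /conn_add {xy}[] : conn (add (del e x y) c d) x y.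
  by apply: xy => u v [[uv|cduv] nuv]; [left|right].
- exact: eA.
- have sub : subrel_of (del e x y) e by move=> u v [].
  move=> [/(conn_sub sub) /(conn_sym es) cx] /(conn_sub sub) /(conn_sym es) dy.
  by apply: ncd; apply: conn_trans cx (conn_trans (conn1 exy) dy).
- have sub : subrel_of (del e x y) e by move=> u v [].
  move=> [/(conn_sub sub) xd] /(conn_sub sub) cy.
  by apply: ncd; apply: conn_trans cy (conn_trans (conn1 (es _ _ exy)) xd).
Qed.

(** Take [p] right after the last visit to [c]: from there on the walk avoids [c], hence also the
    edge [c p]. *)
Lemma conn_first e c d : conn e c d -> c <> d ->
  exists2 p, e c p & conn (del e c p) p d.
Proof.
pose r u v := [/\ e u v, u <> c & v <> c].
have H x : conn e c x -> c = x \/ exists2 p, e c p & conn r p x.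
  elim=> [|u v _ IH uv]; first by left.
  have [->|nv] := pselect (v = c); first by left.
  right; case: IH => [cu|[p cp pu]]; first by exists v; [rewrite cu|exact: conn0].
  have [uc|nu] := pselect (u = c).
    by exists v; [rewrite -uc|exact: conn0].
  by exists p => //; apply: connS pu _.
move=> /H[//|[p cp pd] _]; exists p => //.
by apply: conn_sub pd => u v [uv uc vc]; split=> // -[[]|[_]].
Qed.
 
(* A connection through the union of a chain only uses finitely many edges. *)
Lemma conn_chain (I : Type) (D : set I) (E : I -> V -> V -> Prop) x y :
  (forall i j, D i -> D j -> subrel_of (E i) (E j) \/ subrel_of (E j) (E i)) ->
  conn (fun u v => exists2 i, D i & E i u v) x y ->
  x = y \/ exists2 i, D i & conn (E i) x y.
Proof.
move=> tot; elim=> [|u v _ IH [j Dj uv]]; first by left.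
right; case: IH => [->|[i Di xu]]; first by exists j => //; exact: conn1.
have [ij|ji] := tot _ _ Di Dj.
  by exists j => //; apply: connS uv; exact: conn_sub xu.
by exists i => //; apply: connS xu _; exact: ji.
Qed.

Lemma acyclic_chain (I : Type) (D : set I) (E : I -> V -> V -> Prop) :
  (forall i j, D i -> D j -> subrel_of (E i) (E j) \/ subrel_of (E j) (E i)) ->
  (forall i, D i -> acyclic (E i)) ->
  acyclic (fun u v => exists2 i, D i & E i u v).
Proof.
move=> tot EA x y [i Di xy] cxy.
have {cxy} : conn (fun u v => exists2 i, D i & del (E i) x y u v) x y.
  by apply: conn_sub cxy => u v [[j Dj uv] n]; exists j.
case/conn_chain => [j k Dj Dk|xx|[j Dj cxy]].
- by have [jk|kj] := tot _ _ Dj Dk; [left|right] => u v [? ?]; split=> //;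
    [exact: jk | exact: kj].
- by apply: (EA _ Di _ _ xy); rewrite xx; exact: conn0.
have [ij|ji] := tot _ _ Di Dj.
  exact: (EA _ Dj _ _ (ij _ _ xy)).
apply: (EA _ Di _ _ xy); apply: conn_sub cxy => u v [uv n].
by split=> //; exact: ji.
Qed.

(** A connection avoiding the edge [x y], shortened to a simple path, is closed by that edge;
    conversely, a cycle without its closing edge still connects the ends of that edge. *)
Lemma acyclic_has_cycle e : symm e -> (forall x, ~ e x x) ->
  ~ has_cycle e <-> acyclic e.
Proof.
move=> es ei; split=> [ncyc x y xy cxy|eA [n [c [n3 cI cE]]]].
  pose r := del e x y.
  have [p pP py] : exists2 p : seq {classic V},
      @path {classic V} (fun u v => `[<r u v>]) x p & y = last (x : {classic V}) p.
    elim: cxy => [|u v _ [p pP pu] uv]; first by exists [::].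
    exists (rcons p v); last by rewrite last_rcons.
    rewrite rcons_path pP -[last _ _]pu; exact/asboolP.
  case: (@shortenP {classic V} _ _ _ pP) py => q qP qU _ qy; apply: ncyc.
  (* Loops are excluded and [x y] is deleted, so the path has at least two edges and the cycle at
     least three. *)
  have q2 : 1 < size q.
    case: q qP qU qy => [|z []] //=; first by move=> _ _ yx; case: (ei x); rewrite -{2}yx.
    by move=> /andP[/asboolP[_ H] _] _ yz; case: H; left.
  exists (size (x :: q)), (fun i => nth (x : {classic V}) (x :: q) i); split=> //.
    move=> i j cij; apply/val_inj/eqP.
    rewrite -(nth_uniq (x : {classic V}) (ltn_ord i) (ltn_ord j) qU).
    by move: cij => /= ->.
  move=> i; have := ltn_ord i; rewrite [X in _ < X]/= ltnS leq_eqVlt.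
  case/orP => [/eqP iq|iq].
    rewrite /ordS /= iq modnn /= -[nth _ _ _]/(nth (x : {classic V}) (x :: q) (size q)).
    by rewrite nth_last /= -qy; exact: es.
  rewrite /= modn_small ?ltnS //.
  by have /(pathP (x : {classic V}))/(_ i iq)/asboolP[] := qP.
case: n => // m in c n3 cI cE *.
have e0 : ordS (ord_max : 'I_m.+1) = ord0 by apply: val_inj; rewrite /= modnn.
have := cE ord_max; rewrite e0 => /eA; apply; apply: conn_sym.
  exact: symm_del.
have H k : k <= m -> conn (del e (c ord_max) (c ord0)) (c ord0) (c (inord k)).
  elim: k => [|k IH] km.
    suff -> : inord 0 = ord0 :> 'I_m.+1 by exact: conn0.
    by apply: val_inj; rewrite /= inordK.
  apply: connS (IH (ltnW km)) _.
  have eS : ordS (inord k : 'I_m.+1) = inord k.+1.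
    by apply: val_inj; rewrite /= !inordK ?modn_small // ltnS ltnW.
  split; first by rewrite -eS.
  case=> -[/cI /(congr1 val) + /cI /(congr1 val)];
    rewrite /= !inordK ?ltnS // ?(ltnW km) //.
  (* The remaining case has k = 0 and k + 1 = m, against the length m + 1 being at least 3. *)
  by move=> k0 km'; move: n3; rewrite -km' k0.
by have := H m (leqnn m); congr (conn _ _ (c _)); apply: val_inj; rewrite /= inordK.
Qed.

End Connectivity.

(** * Maximal forests *)

Section MaximalForests.
Variable H : sgraph.
Implicit Types (F : subgraph H) (a b c d x y : H).

Lemma symm_sadj F : symm (@sadj H F).
Proof. exact: sadj_sym. Qed.

Lemma sadj_adj F x y : sadj F x y -> adj x y.
Proof. by case/sadj_sub. Qed.

Lemma forestE F : forest F <-> acyclic (sadj F).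
Proof.
apply: acyclic_has_cycle; first exact: symm_sadj.
by move=> x /sadj_adj /adj_irr.
Qed.

Definition spanning_subgraph (e : H -> H -> Prop) (es : symm e)
    (eadj : subrel_of e (@adj H)) : subgraph H :=
  @Subgraph H setT e es (fun x y exy => And3 (eadj x y exy) I I).

(** A missing vertex, or an edge with unconnected ends, could be added to a forest; conversely, any
    further edge closes a cycle with the connection of its ends. *)
Lemma maximal_forestP F : maximal_forest F <->
  [/\ sverts F = setT, acyclic (sadj F) & subrel_of (@adj H) (conn (sadj F))].
Proof.
split=> [[/forestE FA Fmax]|[FV FA Fspan]]; last first.
  split; first exact/forestE.
  move=> [F' [/forestE F'A [[_ sub] nsub]]]; apply: nsub; split=> [x _|a b ab].
    by rewrite FV.
  apply: contrapT => nab; apply: (F'A _ _ ab).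
  apply: conn_sub (Fspan _ _ (sadj_adj ab)) => u v uv; split; first exact: sub.
  by case=> -[eu ev]; apply: nab; rewrite -eu -ev //; exact: sadj_sym.
split=> //.
  apply: contrapT => nV; apply: Fmax.
  exists (spanning_subgraph (@symm_sadj F) (@sadj_adj F)); split; first exact/forestE.
  split=> // -[sV _]; apply: nV; apply/seteqP; split=> // x _; exact: sV.
move=> x y xy; apply: contrapT => nxy; apply: Fmax.
have sub : subrel_of (add (sadj F) x y) (@adj H).
  move=> u v [/sadj_adj //|[[-> ->] //|[-> ->]]]; exact: adj_sym.
exists (spanning_subgraph (symm_add (@symm_sadj F)) sub); split.
  by apply/forestE; apply: acyclic_add => //; exact: symm_sadj.
split; first by split=> // u v; left.
move=> [_ sub']; apply: nxy; apply: conn1; apply: sub'.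
by right; left.
Qed.

Lemma maximal_forest_inj F F' : maximal_forest F -> maximal_forest F' ->
  (forall x y, sadj F x y <-> sadj F' x y) -> F = F'.
Proof.
move=> /maximal_forestP[FV _ _] /maximal_forestP[F'V _ _].
case: F F' FV F'V => [V e es eV] [V' e' es' eV'] /= VE VE' ee'.
have {}ee' : e = e' by apply/funext => x; apply/funext => y; exact/propext.
by subst; congr Subgraph; exact: Prop_irrelevance.
Qed.

(** Zorn's lemma for the sets [X] of pairs whose union with [e] is an acyclic subgraph. *)
Lemma maximal_forest_extend (e : H -> H -> Prop) :
  symm e -> subrel_of e (@adj H) -> acyclic e ->
  exists2 F, maximal_forest F & subrel_of e (sadj F).
Proof.
move=> es eadj eA.
pose E (X : set (H * H)) x y := X (x, y) \/ e x y.
pose P X := [/\ symm (E X), subrel_of (E X) (@adj H) & acyclic (E X)].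
have [F FP tot|X [[Xs Xadj XA] Xmax]] := @Zorn_bigcup (H * H) P.
  (* Adjoining the empty set to the chain keeps [e] in the union even when [F] is empty. *)
  pose D X := F X \/ X = set0.
  have EU : E (\bigcup_(X in F) X) = (fun u v => exists2 X, D X & E X u v).
    apply/funext => x; apply/funext => y; apply/propext; split.
      move=> [[X FX Xxy]|xy]; first by exists X; [left|left].
      by exists set0; [right|right].
    move=> [X [FX|->] [Xxy|xy]]; [|by right|by []|by right].
    by left; exists X.
  have EP X : D X -> [/\ symm (E X), subrel_of (E X) (@adj H) & acyclic (E X)].
    move=> [/FP //|->]; split=> [x y|x y|]; [|by case=> // /eadj|].
      by case=> // /es; right.
    by apply: acyclic_sub eA => x y [].
  rewrite /P EU; split.
  - by move=> x y [X DX /(let: And3 h _ _ := EP X DX in h)]; exists X.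
  - by move=> x y [X DX]; have [_ h _] := EP X DX; exact: h.
  apply: acyclic_chain => [X Y DX DY|X /EP[] //].
  have [XY|YX] : X `<=` Y \/ Y `<=` X.
    case: DX DY => [FX|->] [FY|->]; [exact: tot|by right|by left|by left].
    by left=> x y [/XY|]; [left|right].
  by right=> x y [/YX|]; [left|right].
pose F := spanning_subgraph Xs Xadj.
exists F; last by right.
split; first exact/forestE.
move=> [F' [/forestE F'A [[_ sub] nsub]]]; apply: (Xmax [set p | sadj F' p.1 p.2]).
  split; first by move=> [x y] Xxy; apply: sub; left.
  by move=> sub'; apply: nsub; split=> // x y xy; left; exact: (sub' (x, y)).
have EE : E [set p | sadj F' p.1 p.2] = sadj F'.
  apply/funext => x; apply/funext => y; apply/propext; split; last by left.
  by case=> // exy; apply: sub; right.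
by rewrite /P EE; split=> //; [exact: symm_sadj|exact: sadj_adj].
Qed.

(** [F] connects [c] and [d] only across [a b], so the new edge [c d] reconnects [a] and [b]. *)
Lemma forest_exchange F a b c d : maximal_forest F ->
  sadj F a b -> adj c d -> ~ sadj F c d -> ~ conn (del (sadj F) a b) c d ->
  exists2 F', maximal_forest F' &
    sverts F' = sverts F /\ sadj F' = add (del (sadj F) a b) c d.
Proof.
move=> /maximal_forestP[FV FA Fspan] ab cd ncd dcd.
set r := del (sadj F) a b in dcd *.
have rs : symm r by apply: symm_del; exact: symm_sadj.
have r's : symm (add r c d) by exact: symm_add.
have sub : subrel_of (add r c d) (@adj H).
  move=> x y [[/sadj_adj //]|[[-> ->] //|[-> ->]]]; exact: adj_sym.
exists (spanning_subgraph r's sub) => //; apply/maximal_forestP; split=> //=.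
  apply: acyclic_add => //; apply: acyclic_sub FA; by move=> x y [].
have Fr x y : sadj F x y -> add r a b x y.
  by move=> xy; have [|n] := pselect (same_edge a b x y); [right|left].
have rr' : subrel_of r (add r c d) by move=> x y; left.
have con_ab : conn (add r c d) a b.
  have cd' : conn (add r c d) c d by apply: conn1; right; left.
  have cdab : conn (add r a b) c d by exact: conn_sub Fr (Fspan _ _ cd).
  case: (conn_add cdab) => [/dcd //||].
    move=> [/(conn_sub rr') ca /(conn_sub rr') bd].
    apply: conn_trans (conn_sym r's ca) _.
    exact: conn_trans cd' (conn_sym r's bd).
  move=> [/(conn_sub rr') cb /(conn_sub rr') ad].
  exact: conn_trans ad (conn_trans (conn_sym r's cd') cb).
move=> x y /Fspan; apply: conn_mono => u v uv.
have [ruv|[[-> ->] //|[-> ->]]] := Fr _ _ uv; last exact: conn_sym.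
by apply: conn1; exact: rr'.
Qed.

End MaximalForests.

(** * Triangles in forest graphs, and the size of forest graphs *)

Definition in_triangle (K : sgraph) (v : K) : Prop :=
  exists y z : K, [/\ adj v y, adj v z & adj y z].

Lemma triangle_cyclic (K : sgraph) (v : K) : in_triangle v -> ~ acyclic (@adj K).
Proof.
move=> [y [z [vy vz yz]]] /(_ _ _ vy); apply.
have nvy : v <> y by move=> e; case: (@adj_irr K v); rewrite {2}e.
have nvz : v <> z by move=> e; case: (@adj_irr K v); rewrite {2}e.
have nyz : y <> z by move=> e; case: (@adj_irr K y); rewrite {2}e.
apply: (@connS _ _ _ z); first (apply: conn1; split=> //).
  by move=> [[_ /esym]|[]].
split; first exact: adj_sym.
by move=> [[/esym]|[/esym]].
Qed.

Lemma forest_graph_in_triangle (H : sgraph) (T : forest_graph H) :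
  ~ acyclic (@adj H) -> in_triangle T.
Proof.
move=> Hcyc; case: T => T Tm; have /maximal_forestP[TV TA Tspan] := Tm.
have [c [d [cd ncd]]] : exists c d : H, adj c d /\ ~ sadj T c d.
  apply: contrapT => none; apply: Hcyc; apply: acyclic_sub TA => x y xy.
  by apply: contrapT => nxy; apply: none; exists x, y.
have Ts := @symm_sadj H T.
have cdT := Tspan _ _ cd.
have c_d : c <> d by move=> e; case: (@adj_irr H c); rewrite {2}e.
have [p cp pd] := conn_first cdT c_d.
have [q dq qc] := conn_first (conn_sym Ts cdT) (nesym c_d).
(* Since [p] reaches [d] without [c p], a connection of [c] and [d] avoiding [c p] would close a
   cycle in [T]. *)
have ncp : ~ conn (del (sadj T) c p) c d.
  move=> cd'; exact: TA cp (conn_trans cd' (conn_sym (symm_del Ts) pd)).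
have ndq : ~ conn (del (sadj T) d q) c d.
  move=> /(conn_sym (symm_del Ts)) dc.
  exact: TA dq (conn_trans dc (conn_sym (symm_del Ts) qc)).
have [T1 T1m [V1 E1]] := forest_exchange Tm cp cd ncd ncp.
have [T2 T2m [V2 E2]] := forest_exchange Tm dq cd ncd ndq.
exists (exist _ T1 T1m), (exist _ T2 T2m); split.
- by exists c, p, c, d; split=> // x y; rewrite E1.
- by exists d, q, c, d; split=> // x y; rewrite E2.
(* [T2] arises from [T1] by removing [d q] and restoring [c p]. *)
exists d, q, c, p; rewrite /= V1 V2.
have cpT x y : same_edge c p x y -> sadj T x y.
  by case=> -[-> ->] //; exact: sadj_sym.
have cdT' x y : same_edge c d x y -> ~ sadj T x y.
  by case=> -[-> ->] // /sadj_sym.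
(* If the two edges coincided, then [c = d] or the chord [c d] would lie in [T]. *)
have disj x y : same_edge d q x y -> ~ same_edge c p x y.
  move=> dqxy cpxy; case: dqxy cpxy => -[-> ->] [] [e1 e2].
  - by apply: c_d; rewrite e1.
  - by apply: ncd; rewrite e1.
  - by apply: ncd; rewrite e2.
  - by apply: c_d; rewrite e2.
have dqT x y : same_edge d q x y -> sadj T x y.
  by case=> -[-> ->] //; exact: sadj_sym.
split=> //.
- rewrite E1; left; split=> //; apply: disj; by left.
- by rewrite E1 => -[[_ []]|/cdT']; [left|apply].
move=> x y; rewrite E1 E2 /add /del.
have := @cpT x y; have := @cdT' x y; have := @disj x y; have := @dqT x y.
by have [] := pselect (same_edge c p x y); tauto.
Qed.

Lemma forest_graph_inj (H : sgraph) (T T' : forest_graph H) :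
  (forall x y, sadj (sval T) x y <-> sadj (sval T') x y) -> T = T'.
Proof.
case: T T' => [T Tm] [T' T'm] TT'.
by apply: eq_exist; exact: maximal_forest_inj.
Qed.

(** Every maximal forest of an acyclic [H] contains all its edges, so there is only one. *)
Lemma infinite_forest_graph_cyclic (H : sgraph) :
  embeds nat (forest_graph H) -> ~ acyclic (@adj H).
Proof.
move=> [f fI] HA; suff /fI : f 0 = f 1 by [].
have full (T : forest_graph H) x y : adj x y -> sadj (sval T) x y.
  case: T => T /= /maximal_forestP[_ TA Tspan] xy; apply: contrapT => nT.
  apply: (HA _ _ xy); apply: conn_sub (Tspan _ _ xy) => u v uv.
  split; first exact: sadj_adj uv.
  by case=> -[eu ev]; apply: nT; rewrite -eu -ev //; exact: sadj_sym.
by apply: forest_graph_inj => x y; split=> /sadj_adj; exact: full.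
Qed.

Lemma forest_graph_embeds_set (H : sgraph) :
  embeds (forest_graph H) (set (H * H)).
Proof.
exists (fun T => [set p | sadj (sval T) p.1 p.2]) => T T' TT'.
apply: forest_graph_inj => x y; have := congr1 (fun X : set (H * H) => X (x, y)) TT'.
by rewrite /= => ->.
Qed.

Lemma infinite_forest_graph (H : sgraph) :
  embeds nat (forest_graph H) -> embeds nat H.
Proof.
move=> /embeds_trans/(_ (forest_graph_embeds_set H)) /infinite_of_set.
rewrite -!infinite_embeds -setXTT => inf fin; apply: inf; exact: finite_setX.
Qed.

(** * Independent binary choices in a graph covered by triangles *)

Section Switches.
Variable K : sgraph.
Implicit Types (x y z v : K).

(* A triangle whose vertex [tip] is joined to [opt1] or to [opt2]; the edge
   [opt1 opt2] is added as well when [joined]. *)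
Record switch := Switch { tip : K; opt1 : K; opt2 : K; joined : bool }.

Implicit Types (q : switch) (S Q : set switch).

Definition on_triangle q :=
  [/\ adj (tip q) (opt1 q), adj (tip q) (opt2 q) & adj (opt1 q) (opt2 q)].

Definition switch_edge S q x y : Prop :=
  same_edge (tip q) (if `[<S q>] then opt1 q else opt2 q) x y \/
  joined q /\ same_edge (opt1 q) (opt2 q) x y.

Definition switch_graph S Q x y : Prop := exists2 q, Q q & switch_edge S q x y.

(** The last two clauses make the choices exclusive: the options of [q] are always connected, so a
    forest containing the graph of a choice [S] with [q] in [S] cannot contain the edge from [tip q]
    to [opt2 q]. *)
Definition independent Q : Prop :=
  [/\ forall q, Q q -> on_triangle q,
      forall S, acyclic (switch_graph S Q),
      forall S q, Q q -> conn (switch_graph S Q) (opt1 q) (opt2 q) &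
      forall S q, Q q -> S q -> ~ switch_graph S Q (tip q) (opt2 q)].

Lemma symm_switch_graph S Q : symm (switch_graph S Q).
Proof.
move=> x y [q Qq [xy|[jq xy]]]; exists q => //.
  by left; exact: same_edge_sym.
by right; split=> //; exact: same_edge_sym.
Qed.

Lemma switch_graph_adj S Q :
  (forall q, Q q -> on_triangle q) -> subrel_of (switch_graph S Q) (@adj K).
Proof.
move=> QT x y [q /QT[a1 a2 a12]].
by rewrite /switch_edge; case: ifP => _ [|[_]] [] [-> ->] //; exact: adj_sym.
Qed.

(** Changing a choice moves a tip between two options that stay connected, so the components do not
    depend on [S]. *)
Lemma conn_switch_graph S S' Q x y : independent Q ->
  conn (switch_graph S Q) x y -> conn (switch_graph S' Q) x y.
Proof.
move=> [_ _ Qc _]; apply: conn_mono => {}x {}y [q Qq xy].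
have gs := @symm_switch_graph S' Q.
have tip_opt (b : bool) :
    conn (switch_graph S' Q) (tip q) (if b then opt1 q else opt2 q).
  have tipS' : conn (switch_graph S' Q) (tip q)
      (if `[<S' q>] then opt1 q else opt2 q).
    by apply: conn1; exists q => //; left; left.
  apply: (conn_trans tipS'); case: b `[<S' q>] => [] [];
    [exact: conn0| |exact: Qc|exact: conn0].
  by apply: conn_sym => //; exact: Qc.
case: xy => [|[_]] [] [-> ->] //; [exact: conn_sym|exact: Qc|].
by apply: conn_sym => //; exact: Qc.
Qed.

Lemma independent_chain (F : set (set switch)) :
  F `<=` independent -> total_on F subset -> independent (\bigcup_(Q in F) Q).
Proof.
move=> FI tot; split=> [q [Q /FI[QT _ _ _]]|S|S q [Q FQ Qq]|S q [Q FQ Qq] Sq].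
- exact: QT.
- have -> : switch_graph S (\bigcup_(Q in F) Q) =
      (fun x y => exists2 Q, F Q & switch_graph S Q x y).
    apply/funext => x; apply/funext => y; apply/propext; split.
      by move=> [q [Q FQ Qq] xy]; exists Q => //; exists q.
    by move=> [Q FQ [q Qq xy]]; exists q => //; exists Q.
  apply: acyclic_chain => [Q Q' FQ FQ'|Q /FI[] //].
  by have [QQ'|QQ'] := tot _ _ FQ FQ'; [left|right] => x y [q /QQ' Qq xy]; exists q.
- have [_ _ Qc _] := FI _ FQ; apply: conn_sub (Qc S q Qq) => x y [q' Qq' xy].
  by exists q' => //; exists Q.
- move=> [q' [Q' FQ' Qq'] qq']; have [QQ'|QQ'] := tot _ _ FQ FQ'.
    have [_ _ _ Qx] := FI _ FQ'; apply: (Qx S q (QQ' _ Qq) Sq).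
    by exists q'.
  have [_ _ _ Qx] := FI _ FQ; apply: (Qx S q Qq Sq).
  by exists q' => //; exact: QQ'.
Qed.

(** No switch of [Q] touches [v], so [v] is attached as a leaf and closes no cycle. *)
Lemma independent_add Q v : independent Q -> in_triangle v ->
  (forall q, Q q -> [/\ tip q <> v, opt1 q <> v & opt2 q <> v]) ->
  exists2 q, tip q = v & independent (Q `|` [set q]).
Proof.
move=> QI [y [z [vy vz yz]]] nv; have [QT QA Qc Qx] := QI.
(* The edge [y z] is joined only if its ends are not yet connected; by [conn_switch_graph], testing
   [set0] settles this for every choice. *)
pose b := `[<~ conn (switch_graph set0 Q) y z>].
pose q0 := Switch v y z b; exists q0 => //.
have vny : v <> y by move=> e; case: (@adj_irr K v); rewrite {2}e.
have vnz : v <> z by move=> e; case: (@adj_irr K v); rewrite {2}e.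
(* The new graph before [v] is attached; [v] is isolated in it. *)
pose base S := if b then add (switch_graph S Q) y z else switch_graph S Q.
have bases S : symm (base S).
  rewrite /base; case: ifP => _; last exact: symm_switch_graph.
  exact/symm_add/symm_switch_graph.
have baseA S : acyclic (base S).
  rewrite /base; case: ifP => [/asboolP nyz|_]; last exact: QA.
  apply: acyclic_add; [exact: symm_switch_graph|exact: QA|].
  by move=> /(conn_switch_graph set0 QI).
have basev S x : ~ base S x v.
  have gv : ~ switch_graph S Q x v.
    move=> [q /nv[nt n1 n2]]; rewrite /switch_edge.
    by case: ifP => _ [|[_]] [] [e1 e2]; congruence.
  rewrite /base; case: ifP => _ // -[//|[] []]; congruence.
have conn_v S x : x <> v -> ~ conn (base S) v x.
  by move=> xv /(conn_sym (bases S)) xS; case: (conn_last xS) => [//|[u /basev]].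
have graphE S : switch_graph S (Q `|` [set q0]) =
    add (base S) v (if `[<S q0>] then y else z).
  apply/funext => x; apply/funext => x'; apply/propext; split.
    move=> [q [Qq|->]].
      move=> xx'; left; have : switch_graph S Q x x' by exists q.
      by rewrite /base; case: ifP => // _ ?; left.
    move=> [xx'|[/= bT xx']]; first by right.
    by left; rewrite /base bT; right.
  case=> [|xx']; last by exists q0; [right|left].
  rewrite /base; case: ifP => bT.
    case=> [[q Qq xx']|xx']; first by exists q => //; left.
    by exists q0; [right|right].
  by move=> [q Qq xx']; exists q => //; left.
have baseG S x x' : conn (switch_graph S Q) x x' ->
    conn (switch_graph S (Q `|` [set q0])) x x'.
  by apply: conn_sub => u u' [q Qq uu']; exists q => //; left.
split.
- by move=> q [/QT //|->].
- move=> S; rewrite graphE; apply: acyclic_add => //.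
  by apply: conn_v; case: ifP => _; exact: nesym.
- move=> S q [Qq|->]; first exact/baseG/Qc.
  have [yzc|yzc] := pselect (conn (switch_graph set0 Q) y z).
    exact/baseG/(conn_switch_graph S QI yzc).
  apply: conn1; exists q0; first by right.
  by right; split; [exact/asboolP|left].
- move=> S q [Qq|->] Sq; rewrite graphE; last first.
    move=> [/(bases S _ _) /basev //|]; rewrite asboolT //.
    by case=> -[/= e1 e2]; [case: (@adj_irr K y); rewrite -{2}e2|exact: vny].
  (* Were [y z] the edge from [tip q] to [opt2 q], the choice [set0] would already connect its ends,
     and [y z] would not be joined. *)
  have tip_opt S' : conn (switch_graph S' Q) (tip q) (opt2 q).
    apply: (@conn_switch_graph set0) => //; apply: conn1; exists q => //.
    by left; rewrite asboolF //; left.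
  have [nt n1 n2] := nv q Qq.
  case=> [|[] []]; [|congruence|congruence].
  rewrite /base; case: ifP => [/asboolP nyz|_]; last exact: Qx.
  case=> [|yzq]; first exact: Qx.
  apply: nyz.
  case: yzq => -[<- <-]; first exact: tip_opt.
  by apply: conn_sym (tip_opt _); exact: symm_switch_graph.
Qed.

(** In a maximal independent family, an uncovered vertex could become the tip of a further
    switch. *)
Lemma independent_covering : (forall v, in_triangle v) ->
  exists2 Q, independent Q &
    forall v, exists2 q, Q q & [\/ tip q = v, opt1 q = v | opt2 q = v].
Proof.
move=> Ktri; have [Q [QI Qmax]] := Zorn_bigcup independent_chain.
exists Q => // v; apply: contrapT => none.
have nv q : Q q -> [/\ tip q <> v, opt1 q <> v & opt2 q <> v].
  by move=> Qq; split=> e; apply: none; exists q => //;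
    [constructor 1|constructor 2|constructor 3].
have [q qv QqI] := independent_add QI (Ktri v) nv.
apply: Qmax QqI; split; first by left.
by move=> /(_ q (or_intror erefl)) /nv[].
Qed.

(** Each choice graph extends to a maximal forest. If [S] and [S'] had the same forest with [q] in
    [S] only, it would contain both tip edges of [q], which close a cycle with the connection of the
    options. *)
Lemma independent_embeds Q : independent Q ->
  embeds (set {q | Q q}) (forest_graph K).
Proof.
move=> [QT QA Qc Qx].
have /choice[F FP] : forall S, exists T : forest_graph K,
    subrel_of (switch_graph S Q) (sadj (sval T)).
  move=> S; have [T Tm ST] := maximal_forest_extend (@symm_switch_graph S Q)
    (switch_graph_adj (S := S) QT) (QA S).
  by exists (exist _ T Tm).
have sub S S' q : F S = F S' -> Q q -> S q -> S' q.
  move=> FSS' Qq Sq; apply: contrapT => S'q.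
  have [t1 t2 _] := QT _ Qq.
  have tip1 : switch_graph S Q (tip q) (opt1 q).
    by exists q => //; left; case: asboolP => // _; left.
  have tip2 : switch_graph S' Q (tip q) (opt2 q).
    by exists q => //; left; case: asboolP => // _; left.
  have /maximal_forestP[_ TA _] := svalP (F S).
  have T2 : sadj (sval (F S)) (tip q) (opt2 q) by rewrite FSS'; exact: FP.
  have sub' : subrel_of (switch_graph S Q)
      (del (sadj (sval (F S))) (tip q) (opt2 q)).
    move=> x y xy; split; first exact: FP.
    case=> -[ex ey]; apply: (Qx S q Qq Sq); rewrite -ex -ey //.
    exact: symm_switch_graph.
  apply: (TA _ _ T2); apply: conn_sub sub' _.
  exact: conn_trans (conn1 tip1) (Qc S q Qq).
exists (fun A => F [set sval p | p in A]) => A B AB.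
have img (X Y : set {q | Q q}) :
    F [set sval p | p in X] = F [set sval p | p in Y] -> X `<=` Y.
  move=> XY p Xp; have [] := sub _ _ (sval p) XY (svalP p).
    by exists p.
  by move=> p' Yp' /eq_sig_hprop pp'; rewrite -pp' // => ? ? ?; exact: Prop_irrelevance.
by apply/seteqP; split; exact: img.
Qed.

End Switches.

(** Each vertex is one of the three corners of a switch, so the family is infinite and absorbs the
    factor 3. *)
Lemma embeds_set_forest_graph (K : sgraph) :
  embeds nat K -> (forall v : K, in_triangle v) ->
  embeds (set K) (forest_graph K).
Proof.
move=> Kinf /independent_covering[Q QI cover].
apply: embeds_trans (independent_embeds QI); apply: embeds_set.
have K3 : embeds K ({q | Q q} * 'I_3).
  have /choice[f fP] : forall v, exists p : {q | Q q} * 'I_3,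
      nth (tip (sval p.1)) [:: tip (sval p.1); opt1 (sval p.1); opt2 (sval p.1)] p.2 = v.
    move=> v; have [q Qq qv] := cover v.
    by case: qv => <-; [exists (exist _ q Qq, inord 0)|exists (exist _ q Qq, inord 1)
      |exists (exist _ q Qq, inord 2)]; rewrite /= inordK.
  by exists f => x y xy; rewrite -(fP x) -(fP y) xy.
apply: (embeds_trans K3); apply: infinite_mul_finite.
have := embeds_trans Kinf K3; rewrite -!infinite_embeds => inf fin.
by apply: inf; rewrite -setXTT; exact: finite_setX.
Qed.

(** * Iterated forest graphs *)

Lemma isomorphic_embeds (G H : sgraph) :
  isomorphic G H -> embeds G H /\ embeds H G.
Proof.
move=> [f [[g fK gK] _]]; split; first by exists f; exact: can_inj fK.
by exists g; exact: can_inj gK.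
Qed.

Lemma infinite_forest_graph_iter (n : nat) (K : sgraph) :
  embeds nat (forest_graph_iter n K) -> embeds nat K.
Proof. by elim: n => // n IH /infinite_forest_graph. Qed.

(* The bound on the square is what makes the induction go through without
   knowing that an infinite cardinal is equal to its square. *)
Lemma forest_graph_iter_upper (n : nat) (K : sgraph) :
  embeds nat (forest_graph_iter n K) ->
  embeds (forest_graph_iter n K * forest_graph_iter n K) (iter_set n.+1 K).
Proof.
rewrite iter_setSr; elim: n => [Kinf|n IH inf] /=.
  apply: embeds_trans (infinite_set_sq Kinf).
  by apply: embeds_prod; exact: embeds_set_self.
set L := forest_graph_iter n K in IH inf *.
have Linf : embeds nat L by exact: infinite_forest_graph.
have FL := @forest_graph_embeds_set L.
apply: embeds_trans (embeds_prod FL FL) _.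
apply: embeds_trans (embeds_set (IH Linf)).
apply: infinite_set_sq; apply: (embeds_trans Linf).
by exists (fun x => (x, x)) => x y [].
Qed.

Lemma forest_graph_iter_lower (n : nat) (K : sgraph) :
  embeds nat K -> (forall v : K, in_triangle v) ->
  embeds (iter_set n K) (forest_graph_iter n K).
Proof.
move=> Kinf Ktri.
(* Infinity and the triangle property are carried along because the next lower bound needs both. *)
suff [] : [/\ embeds nat (forest_graph_iter n K),
    forall v : forest_graph_iter n K, in_triangle v &
    embeds (iter_set n K) (forest_graph_iter n K)] by [].
elim: n => [|n [inf tri low]] /=; first by split=> //; exact: embeds_refl.
set L := forest_graph_iter n K in inf tri low *.
have LF := embeds_set_forest_graph inf tri.
have [f _] := inf.
split; last exact: embeds_trans (embeds_set low) LF.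
  exact: embeds_trans inf (embeds_trans (@embeds_set_self L) LF).
by move=> T; apply: forest_graph_in_triangle; exact: triangle_cyclic (tri (f 0)).
Qed.

(** * Comparison of iterated roots, and finiteness of the depth *)

Lemma not_iterated_forest_graph (G : sgraph) : infinite_graph G ->
  exists n, ~ exists H, isomorphic G (forest_graph_iter n H).
Proof.
move=> /infinite_embeds Ginf; apply: contrapT => /forallNP all.
(* One extra iteration makes the base [K n] itself a forest graph, so that its vertices lie in
   triangles. *)
have /choice[H HP] : forall n, exists H,
    isomorphic G (forest_graph_iter n (forest_graph H)).
  move=> n; have [H GH] := contrapT (all n.+1).
  by exists H; rewrite /forest_graph_iter -iterSr.
pose K n := forest_graph (H n).
have GK n : embeds G (forest_graph_iter n (K n)) by case: (isomorphic_embeds (HP n)).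
have KG n : embeds (forest_graph_iter n (K n)) G by case: (isomorphic_embeds (HP n)).
have inf n := embeds_trans Ginf (GK n).
have Kinf n : embeds nat (K n) by exact: infinite_forest_graph_iter (inf n).
have Ktri n (v : K n) : in_triangle v.
  exact/forest_graph_in_triangle/infinite_forest_graph_cyclic/Kinf.
have [m mP] := least_cardinal K.
(* The upper bound for m iterations has m + 1 power sets, so level m + 2 is the first to contradict
   it. *)
apply: (@cantor (iter_set m.+1 (K m))).
apply: (@embeds_trans (iter_set m.+2 (K m.+2))); first exact: (@embeds_iter_set m.+2).
apply: embeds_trans (forest_graph_iter_lower m.+2 (Kinf _) (@Ktri _)) _.
apply: embeds_trans (KG _) (embeds_trans (GK m) _).
apply: embeds_trans (forest_graph_iter_upper (inf m)).
by exists (fun x => (x, x)) => x y [].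
Qed.

Theorem theorem6p2 (G : sgraph) (Ginf : infinite_graph G) :
  exists d : nat, is_Fdepth G (Fin d).
Proof.
have [root|noroot] := pselect (exists H, Froot G H); last by exists 0; right.
pose S := [set n | exists H, isomorphic G (forest_graph_iter n H)].
(* The n-th iterate of [H] is the m-th iterate of its (n - m)-th iterate. *)
have down m n : m <= n -> S n -> S m.
  move=> mn [H GH]; exists (forest_graph_iter (n - m) H).
  by rewrite /forest_graph_iter -iterD subnKC.
have S0 : S 0 by exists G, id; split=> //; exists id.
have exN : exists n, ~~ `[<S n>].
  by have [n nS] := not_iterated_forest_graph Ginf; exists n; apply/asboolPn.
(* The least index outside [S] is positive, and by [down] its predecessor [d] is the maximum of
   [S]. *)
case: (ex_minnP exN) => -[|d] /asboolPn nSd dmin; first by [].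
exists d; left; split=> //; split=> [n Sn|u]; last first.
  apply; apply: contrapT => /asboolPn /dmin; by rewrite ltnn.
by rewrite /= leqNgt; apply/negP => dn; apply: nSd; exact: down dn Sn.
Qed.
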